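(* Let $X$ be a metrizable space, $A\subset X$ be a closed set, $E$ be a locally convex topological vector space, and $\Phi:X\leadsto E$ be a convex-valued open relation. Then every continuous selection $g:A\to E$ for $\Phi\upharpoonright A$ can be extended to a continuous selection for $\Phi$.
   Context: All topological spaces (including topological vector spaces) are assumed Hausdorff and all vector spaces are real. For a relation $\Phi\subset X\times Y$, $\Phi(x)=\{y\in Y:\langle x,y\rangle\in\Phi\}$; writing $\Phi:X\leadsto Y$ means that $\Phi(x)\neq\varnothing$ for every $x\in X$. $\Phi$ is open if it is an open subset of the product space $X\times Y$, and convex-valued if each $\Phi(x)$ is convex. A selection for $\Phi:X\leadsto Y$ is a map $f:X\to Y$ with $f(x)\in\Phi(x)$ for every $x\in X$. $\Phi\upharpoonright A$ is the restriction of $\Phi$ to $A$, so a selection for $\Phi\upharpoonright A$ is a map $g:A\to Y$ with $g(x)\in\Phi(x)$ for every $x\in A$. *)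

(* Defs.v *)
From HB Require Import structures.
From mathcomp Require Import all_boot all_order all_algebra.
From mathcomp Require Import all_classical all_reals.
From mathcomp Require Import topology convex tvs.

Set Implicit Arguments.
Unset Strict Implicit.
Unset Printing Implicit Defensive.

Import Order.TTheory GRing.Theory Num.Theory.
Local Open Scope classical_set_scope.
Local Open Scope ring_scope.

Section metrizability.
Context (R : realType).

Definition is_metric (T : Type) (d : T -> T -> R) : Prop :=
  [/\ forall x, d x x = 0,
      forall x y, d x y = 0 -> x = y,
      forall x y, d x y = d y x
    & forall x y z, d x z <= d x y + d y z].

Definition metrizable (X : topologicalType) : Prop :=
  exists d : X -> X -> R, is_metric d /\
    forall (x : X) (U : set X),
      nbhs x U <-> exists2 e : R, 0 < e & [set y | d x y < e] `<=` U.

End metrizability.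

(* For a relation Phi included in X * Y, the value Phi(x) is the library's
   section [xsection Phi x] = {y | (x, y) \in Phi}. *)
Section relations.
Context (X Y : Type).
Implicit Type Phi : set (X * Y).

Definition nonempty_valued Phi : Prop := forall x, xsection Phi x !=set0.

Definition restrict_rel Phi (A : set X) : set (A * Y) :=
  [set p | Phi (\val p.1, p.2)].

Definition selection Phi (f : X -> Y) : Prop := forall x, xsection Phi x (f x).

End relations.

Arguments restrict_rel {X Y} Phi A _ : assert.

Definition convex_valued (R : realType) (X : Type) (E : lmodType R)
    (Phi : set (X * E)) : Prop :=
  forall x, convex_set (xsection Phi x).

(* Main.v *)
Require Import Defs.
From HB Require Import structures.
From mathcomp Require Import all_boot all_order all_algebra.
From mathcomp Require Import all_classical all_reals.
From mathcomp Require Import topology convex tvs.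
From mathcomp Require Import wochoice interval_inference normedtype.
From mathcomp Require Import lra.

Set Implicit Arguments.
Unset Strict Implicit.
Unset Printing Implicit Defensive.

(** The proof is Dugundji's extension argument with the values taken in [Phi].

    The engine is [open_fiber_selection]: if [Psi : X -> set E] has open fibers
    [{z | Psi z c}] over a metric space, then there is a map [h], continuous
    wherever [Psi] is nonempty, with [h z] in the convex hull of [Psi z]. The
    classical proof takes a locally finite partition of unity subordinate to
    the fibers. Here Stone's argument is condensed as follows. Let [s] choose
    least elements for a well-order of [E], and let [F n] be the set of those
    [y] for which [s (Psi y)] is a value of [Psi] on the whole ball of radius
    [rho n = 1 / (n + 1)] around [y]. Two points of [F n] closer than [rho n]
    each have a chosen value that is admissible at the other, so their choices
    agree ([coherent_choice]). Hence each level [n] carries a single locally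
    constant map [c n] near [F n], cut off by a single bump function [w n]
    ([metric_bump]), and the levels are indexed by natural numbers rather than
    by an infinite cover. They are combined into
    [w 0 *: c 0 + (1 - w 0) *: (w 1 *: c 1 + (1 - w 1) *: ...)], which stops at
    the first level with [w k = 1]. As the interiors of the sets [w k = 1]
    cover the domain of [Psi], this is locally a finite nested combination,
    hence continuous, and it needs no normalisation.

    To extend [g], the engine is applied off [A] to the values [c] of [Phi z]
    that are also prescribed by some nearby [x]: if [g] at an almost nearest
    point [p x] of [A] is a value of [Phi x], then [c] must be [g (p x)]. Near
    a point [a] of [A] the openness of [Phi] and the continuity of [g] make
    this prescription effective, so all admissible values lie in any given
    convex neighbourhood of [g a], and so does the extension. Local convexity
    enters only there. *)

Import Order.TTheory GRing.Theory Num.Theory.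
Import numFieldTopology.Exports.
Local Open Scope classical_set_scope.
Local Open Scope ring_scope.

(** * Choosing values coherently *)

(** Taking least elements for a well-order is a choice rule satisfying
    revealed preference: if each of two sets contains the element chosen from
    the other, both choices agree. This is all that the construction of a
    discrete family of patches uses of the well-order. *)
Lemma coherent_choice (T : choiceType) (t0 : T) : exists s : set T -> T,
  (forall P, P !=set0 -> P (s P)) /\
  (forall P Q, P (s Q) -> Q (s P) -> s P = s Q).
Proof.
have [le le_wo] := well_ordering_principle T.
pose least (P : set T) t := P t /\ forall u, P u -> le t u.
have leastP (P : set T) : P !=set0 -> exists! t, least P t.
  move=> [t Pt]; have [|u [[Pu ule] uuniq]] := le_wo (fun t => `[< P t >]).
    by exists t; apply/asboolP.
  exists u; split=> [|v [Pv vle]].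
    split=> [|v Pv]; first exact/asboolP.
    by apply: ule; apply/asboolP.
  apply: uuniq; split=> [|x]; first exact/asboolP.
  by move=> /asboolP; exact: vle.
pose s P := xget t0 (least P).
have sP (P : set T) : P !=set0 -> least P (s P).
  by move=> /leastP[t [lt _]]; exact: (xgetPex t0 (ex_intro _ t lt)).
exists s; split=> [P /sP[]//|P Q PsQ QsP].
have [PsP leP] := sP P (ex_intro _ _ PsQ).
have [QsQ leQ] := sP Q (ex_intro _ _ QsP).
have [|t [_ tuniq]] := leastP [set u | u = s P \/ u = s Q].
  by exists (s P); left.
have lr (P' : set T) : P' !=set0 -> le (s P') (s P').
  by move=> /sP[? /(_ (s P'))]; exact.
rewrite -(tuniq (s P)) ?(tuniq (s Q))//; split; [by right| |by left|].
- move=> u [->|->]; first exact: leQ.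
  by apply: lr; exists (s P).
- move=> u [->|->]; last exact: leP.
  by apply: lr; exists (s Q).
Qed.

Lemma convex_set_combination (R : realType) (E : lmodType R) (K : set E)
    (t : R) (u v : E) :
  convex_set K -> 0 <= t <= 1 -> K u -> K v -> K (t *: u + (1 - t) *: v).
Proof.
move=> cK /andP[t0 t1] Ku Kv.
by have /set_mem := cK u v (Itv01 t0 t1) (mem_set Ku) (mem_set Kv).
Qed.

(** * Nested convex combinations *)

Section nested_combination.
Context (R : realType) (E : lmodType R).

(** The telescoped form of the partition of unity with weights
    [w m * \prod_(i < m) (1 - w i)], with [e] receiving the remaining mass. *)
Fixpoint nested (w : nat -> R) (c : nat -> E) (n : nat) (e : E) : E :=
  if n is m.+1 then nested w c m (w m *: c m + (1 - w m) *: e) else e.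

(** A full weight at level [k] leaves no mass for the later levels: this plays
    the role of both local finiteness and normalisation. *)
Lemma nested_stationary (w : nat -> R) (c : nat -> E) (k n : nat) (e : E) :
  w k = 1 -> (k < n)%N -> nested w c n e = nested w c k (c k).
Proof.
move=> wk1; elim: n e => [//|n IHn] e.
rewrite ltnS leq_eqVlt => /orP[/eqP <-|kn].
  by rewrite /= wk1 scale1r subrr scale0r addr0.
exact: IHn.
Qed.

Lemma nested_convex (w : nat -> R) (c : nat -> E) (n : nat) (e : E)
    (K : set E) :
  convex_set K -> (forall m, 0 <= w m <= 1) ->
  (forall m, 0 < w m -> K (c m)) -> K e -> K (nested w c n e).
Proof.
move=> cK w01 Kc; elim: n e => [//|n IHn] e Ke; apply: IHn.
have [wn0|wn0] := ltP 0 (w n).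
  by apply: convex_set_combination => //; exact: Kc.
have -> : w n = 0 by apply/eqP; rewrite eq_le wn0; case/andP: (w01 n).
by rewrite scale0r add0r subr0 scale1r.
Qed.

End nested_combination.

(** Continuity is asked of the products [w n *: c n] rather than of [c n], which
    has no reason to be continuous where [w n] vanishes. *)
Lemma nested_continuous (R : realType) (X : topologicalType)
    (E : topologicalLmodType R) (w : nat -> X -> R) (c : nat -> X -> E)
    (z : X) :
  (forall n, {for z, continuous (w n)}) ->
  (forall n, {for z, continuous (fun x => w n x *: c n x)}) ->
  forall n (e : X -> E), {for z, continuous e} ->
  {for z, continuous (fun x => nested (w ^~ x) (c ^~ x) n (e x))}.
Proof.
move=> wc wcc; elim=> [//|n IHn] e ec.
apply: (IHn (fun x => w n x *: c n x + (1 - w n x) *: e x)).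
apply: (@continuous2_cvg _ E E E (nbhs z) _ _ _ (fun u v => u + v)).
- exact: (@add_continuous _ (_, _)).
- exact: wcc.
- apply: (@continuous2_cvg _ R^o E E (nbhs z) _ (fun x => 1 - w n x) e
    (fun u v => u *: v)).
  + exact: (@scale_continuous _ _ (_, _)).
  + by apply: cvgB; [exact: cvg_cst|exact: wc].
  + exact: ec.
Qed.

(** * Selections over a metrized space *)

Section metrized_space.
Context (R : realType) (X : topologicalType) (d : X -> X -> R).
Hypothesis d_metric : is_metric d.
Hypothesis nbhs_d : forall (x : X) (U : set X),
  nbhs x U <-> exists2 e : R, 0 < e & [set y | d x y < e] `<=` U.

Lemma is_metric_ge0 x y : 0 <= d x y.
Proof.
have [dxx _ dC dD] := d_metric.
by have := dD x y x; rewrite dxx (dC y); lra.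
Qed.

(** A rescaled truncation of the supremum of the cones [2 * r - d y x] with
    [y] in [F]. The supremum is 1-Lipschitz; adding [0] to the family makes
    this cover an empty [F] as well. *)
Lemma metric_bump (F : set X) (r : R) : 0 < r ->
  exists w : X -> R^o, [/\ continuous w,
    forall x, 0 <= w x <= 1,
    forall y x, F y -> d y x < r -> w x = 1
  & forall x, 0 < w x -> exists2 y, F y & d y x < 2 * r].
Proof.
move=> r0; have [dxx _ dC dD] := d_metric.
pose S x := [set u : R | u = 0 \/ exists2 y, F y & u = 2 * r - d y x].
pose t x := sup (S x).
have S0 x : S x 0 by left.
have Sub x : ubound (S x) (2 * r).
  move=> u [->|[y _ ->]]; first lra.
  by have := is_metric_ge0 y x; lra.
have Ssup x : has_sup (S x) by split; [exists 0|exists (2 * r)].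
have tub x u : S x u -> u <= t x.
  by move=> Su; exact: (ub_le_sup (proj2 (Ssup x))).
have t0 x : 0 <= t x by exact: tub.
have tlip x y : t x <= t y + d x y.
  apply: ge_sup; first by exists 0.
  move=> u [->|[z Fz ->]].
    by have := t0 y; have := is_metric_ge0 x y; lra.
  have := tub y (2 * r - d z y); have := dD z x y.
  by move=> ? /(_ (or_intror (ex_intro2 _ _ z Fz erefl))); lra.
have tcont : continuous (t : X -> R^o).
  move=> x; apply/cvgrPdist_lt => e e0; apply/nbhs_d; exists e => // y /= xy.
  rewrite ltr_norml; have := tlip x y; have := tlip y x; rewrite (dC y).
  by move: xy; lra.
exists (fun x => Num.min 1 (t x / r)); split.
- apply: (@min_fun_continuous _ X R (cst 1) (fun x => t x / r)).
    by move=> x; exact: cvg_cst.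
  by move=> x; apply: cvgMr_tmp; exact: tcont.
- by move=> x; rewrite le_min ge_min lexx ler01 divr_ge0// ltW.
- move=> y x Fy yx; apply/min_idPl; rewrite ler_pdivlMr// mul1r.
  have : S x (2 * r - d y x) by right; exists y.
  by move=> /tub; lra.
- move=> x; rewrite lt_min ltr01/= pmulr_lgt0 ?invr_gt0// => tx.
  have [u [->|[y Fy ->]]] := sup_gt (ex_intro _ 0 (S0 x)) tx.
    by rewrite ltxx.
  by exists y => //; lra.
Qed.

(** A form of Browder's selection theorem for metric domains. Quantifying
    over [K] says that [h z] is in the convex hull of [Psi z]; empty values are
    allowed because [Psi] is later used only off a closed set. *)
Lemma open_fiber_selection (E : topologicalLmodType R) (Psi : X -> set E) :
  (forall z c, Psi z c -> \forall y \near z, Psi y c) ->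
  exists h : X -> E, forall z, Psi z !=set0 ->
    {for z, continuous h} /\
    forall K, convex_set K -> Psi z `<=` K -> K (h z).
Proof.
move=> Psi_open; have [dxx _ dC dD] := d_metric.
have [s [sP s_coh]] := coherent_choice (0 : E).
pose rho n : R := n.+1%:R^-1.
have rho0 n : 0 < rho n by rewrite invr_gt0.
pose F n := [set y | Psi y !=set0 /\
  forall z, d y z < rho n -> Psi z (s (Psi y))].
have F_sep n y y' : F n y -> F n y' -> d y y' < rho n -> s (Psi y) = s (Psi y').
  move=> [_ Fy] [_ Fy'] yy'; apply: s_coh; first by apply: Fy'; rewrite dC.
  exact: Fy.
have F_cover y : Psi y !=set0 -> exists n, F n y.
  move=> y0; have /nbhs_d[e e0 eP] := Psi_open _ _ (sP _ y0).
  have [n _ /(_ n (leqnn n)) /= ne] := near_infty_natSinv_lt (PosNum e0).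
  by exists n; split=> // z yz; apply: eP => /=; exact: lt_trans ne.
have rho8 n : 0 < rho n / 8 by rewrite divr_gt0.
have /choice[w w_bump] n := metric_bump (F n) (rho8 n).
(* The coherence of s makes the value independent of the point y of F n chosen
   within rho n / 2 of z. The bump w n vanishes already at distance rho n / 4,
   well inside the region where c n is thus controlled. *)
pose c n z := s (Psi (xget z [set y | F n y /\ d y z < rho n / 2])).
have cE n y z : F n y -> d y z < rho n / 2 -> c n z = s (Psi y).
  move=> Fy yz; rewrite /c.
  case: xgetP => [y' _ [Fy' y'z]|/(_ y)]; last by case.
  apply: F_sep Fy' Fy _; have := dD y' z y; rewrite (dC z y); lra.
have c_Psi n z : 0 < w n z -> Psi z (c n z).
  have [_ _ _ wF] := w_bump n.
  move=> /wF[y Fy yz]; have := rho0 n => r0; rewrite (cE n y)//; last by lra.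
  by apply: Fy.2; lra.
have wc_cont n : continuous (fun z => w n z *: c n z).
  have [w_cont w01 _ wF] := w_bump n.
  move=> z; have r0 := rho0 n.
  have [[y [Fy yz]]|noy] := pselect (exists y, F n y /\ d y z < rho n / 2).
    have nearcE : \forall x \near z, w n x *: s (Psi y) = w n x *: c n x.
      apply/nbhs_d; exists (rho n / 2 - d y z); first by lra.
      move=> x /= zx; rewrite (cE n y x)//.
      by have := dD y z x; lra.
    rewrite /continuous_at (cE n y z)//.
    apply: cvg_trans (near_eq_cvg nearcE) _.
    apply: (@continuous2_cvg _ R^o E E (nbhs z) _ (w n) (cst (s (Psi y)))
      (fun u v => u *: v)).
    + exact: (@scale_continuous _ _ (_, _)).
    + exact: w_cont.
    + exact: cvg_cst.
  have w_far x : d z x < rho n / 4 -> w n x = 0.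
    move=> zx; have [wx|wx] := ltP 0 (w n x).
      have [y Fy yx] := wF _ wx; exfalso; apply: noy; exists y; split => //.
      by have := dD y x z; rewrite (dC x z); lra.
    by apply/eqP; rewrite eq_le wx; case/andP: (w01 x).
  apply: cvg_near_cst; apply/nbhs_d; exists (rho n / 4); first lra.
  by move=> x /= zx; rewrite !w_far ?scale0r// dxx; lra.
pose good z k := w k z = 1.
pose h z := nested (w ^~ z) (c ^~ z) (xget 0%N (good z)).+1 0.
have hE z k : good z k -> h z = nested (w ^~ z) (c ^~ z) k.+1 0.
  move=> zk; rewrite /h; have := xgetPex 0%N (ex_intro _ k zk).
  move: (xget _ _) => k' zk'.
  pose m := (maxn k k').+1.
  rewrite [LHS](nested_stationary _ _ zk')// [RHS](nested_stationary _ _ zk)//.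
  rewrite -(nested_stationary (n := m) _ 0 zk') ?ltnS ?leq_maxr//.
  by rewrite (nested_stationary (n := m) _ 0 zk) ?ltnS ?leq_maxl.
exists h => z z0; have [n Fz] := F_cover z z0.
have near_good : \forall x \near z, good x n.
  apply/nbhs_d; exists (rho n / 8) => // x /= zx.
  by have [_ _ w1 _] := w_bump n; exact: w1 zx.
have zn := nbhs_singleton near_good.
split.
  rewrite /prop_for /continuous_at (hE z n zn).
  have hnear : \forall x \near z, nested (w ^~ x) (c ^~ x) n.+1 0 = h x.
    by apply: filterS near_good => x /hE.
  apply: cvg_trans (near_eq_cvg hnear) _.
  apply: (@nested_continuous _ _ _ w c z _ _ n.+1 (cst 0)).
  - by move=> m; have [wm _ _ _] := w_bump m; exact: wm.
  - by move=> m; exact: wc_cont.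
  - exact: cvg_cst.
move=> K cK PsiK; rewrite (hE z n zn) (nested_stationary _ _ zn)//.
have Kc m : 0 < w m z -> K (c m z) by move=> /c_Psi /PsiK.
apply: nested_convex => //; last by apply: Kc; rewrite zn.
by move=> m; have [_ w01 _ _] := w_bump m; exact: w01.
Qed.

(** A point off the closed set [A] is at positive distance from [A], so some
    point of [A] is within twice that distance. *)
Lemma almost_nearest_point (A : set X) (a0 : A) : closed A ->
  exists p : X -> A, forall x, ~ A x ->
    forall a : A, d x (\val (p x)) < 2 * d x (\val a).
Proof.
move=> Acl.
suff /choice[p pP] : forall x, exists b : A,
    ~ A x -> forall a : A, d x (\val b) < 2 * d x (\val a) by exists p.
move=> x.
have [Ax|nAx] := pselect (A x); first by exists a0.
have /nbhs_d[e e0 eA] : nbhs x (~` A).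
  by apply: open_nbhs_nbhs; split=> //; exact: closed_openC.
pose D := [set r | exists a : A, r = d x (\val a)].
have D0 : D !=set0 by exists (d x (\val a0)), a0.
have De : lbound D e.
  move=> _ [a ->]; rewrite leNgt; apply/negP => /eA; apply.
  exact: set_valP.
have infD_ge := lb_le_inf D0 De.
have inf2 : inf D < 2 * inf D by lra.
have [_ [b ->] bD] := inf_lt D0 inf2.
exists b => _ a; apply: lt_le_trans bD _; rewrite ler_pM2l//.
by apply: ge_inf; [exists e|exists a].
Qed.

(** Dugundji's argument: off [A] the values of the extension are dictated by
    [g] whenever that is compatible with [Phi]. *)
Lemma selection_extension (A : set X) (E : tvsType R) (Phi : set (X * E)) :
  closed A -> nonempty_valued Phi -> convex_valued Phi -> open Phi ->
  forall g : A -> E, continuous g -> selection (restrict_rel Phi A) g ->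
  exists f : X -> E,
    [/\ continuous f, selection Phi f & forall a : A, f (\val a) = g a].
Proof.
move=> Acl Phi0 Phic Phio g gc gPhi; have [dxx _ dC dD] := d_metric.
have Phi_near z c : Phi (z, c) -> nbhs (z, c) Phi.
  by move=> zc; apply: open_nbhs_nbhs.
have Phi_fiber z c : Phi (z, c) -> \forall y \near z, Phi (y, c).
  move=> /Phi_near[[U V] /= [zU cV] UV].
  by apply: filterS zU => y Uy; apply: UV; split=> //; exact: nbhs_singleton cV.
have PhiP x c : xsection Phi x c <-> Phi (x, c).
  by split=> [/xsectionP|?] //; apply/xsectionP.
have [[a0 _]|A0] := pselect ([set: A] !=set0); last first.
  have [h hP] := open_fiber_selection (Psi := fun z c => Phi (z, c)) Phi_fiber.
  have Phi0' z : [set c | Phi (z, c)] !=set0.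
    by have [c /PhiP ?] := Phi0 z; exists c.
  exists h; split.
  - by move=> z; have [] := hP z (Phi0' z).
  - move=> z; have [_ hK] := hP z (Phi0' z); apply: hK; first exact: Phic.
    by move=> c /PhiP.
  - by move=> a; case: A0; exists a.
have [p pP] := almost_nearest_point a0 Acl.
(* The prescription is imposed at a witness x near z rather than at z itself
   because it would not be stable under moving z; the radius keeps z off A. *)
pose Psi z c := exists x, [/\ ~ A x, d x z < d x (\val (p x)) / 4,
  Phi (z, c) & Phi (x, g (p x)) -> c = g (p x)].
have Psi_open z c : Psi z c -> \forall y \near z, Psi y c.
  move=> [x [nAx xz zc xg]].
  have near_ball : \forall y \near z, d x y < d x (\val (p x)) / 4.
    apply/nbhs_d; exists (d x (\val (p x)) / 4 - d x z); first lra.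
    by move=> y /= zy; have := dD x z y; lra.
  have near_Phi := Phi_fiber _ _ zc.
  by apply: filterS2 near_ball near_Phi => y ? ?; exists x.
have Psi0 z : ~ A z -> Psi z !=set0.
  move=> nAz; have dz : d z z < d z (\val (p z)) / 4.
    by have := pP z nAz (p z); rewrite dxx; lra.
  have [zg|zg] := pselect (Phi (z, g (p z))); first by exists (g (p z)), z.
  by have [c /PhiP zc] := Phi0 z; exists c, z.
have [h hP] := open_fiber_selection Psi_open.
pose f z := if insub z is Some a then g a else h z.
have fA (a : A) : f (\val a) = g a by rewrite /f valK.
have fnA z : ~ A z -> f z = h z.
  by move=> nAz; rewrite /f; case: insubP => // a /set_mem.
have memA z : A z -> exists a : A, \val a = z.
  by move=> /mem_set Az; exists (exist _ z Az).
exists f; split => // [z|z].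
- have [/memA[a <-{z}]|nAz] := pselect (A z); last first.
    have nearnA : \forall x \near z, h x = f x.
      have : nbhs z (~` A).
        by apply: open_nbhs_nbhs; split=> //; exact: closed_openC.
      by apply: filterS => x nAx; rewrite fnA.
    rewrite /continuous_at fnA//; apply: cvg_trans (near_eq_cvg nearnA) _.
    by have [] := hP z (Psi0 z nAz).
  rewrite /continuous_at fA => W' W'a.
  have [B Bconv [Bopen Bbasis]] := @locally_convex R E.
  have [W [BW Wa] WW'] := Bbasis _ _ W'a.
  have Wnbhs : nbhs (g a) W by apply: open_nbhs_nbhs; split=> //; exact: Bopen.
  have Wconv : convex_set W by apply: Bconv; exact: mem_set.
  have [[U V] /= [/nbhs_d[e1 e10 e1U] Va] UV] : nbhs (\val a, g a) Phi.
    by apply: Phi_near; have /PhiP := gPhi a.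
  have [_ /= [[O Oopen <-] Oa OWV]] := gc a _ (filterI Wnbhs Va).
  have /nbhs_d[e2 e20 e2O] : nbhs (\val a) O by apply: open_nbhs_nbhs.
  have gWV a' : d (\val a) (\val a') < e2 -> W (g a') /\ V (g a').
    by move=> aa'; apply: OWV; exact: e2O.
  (* With t = d a z, a witness x for a value at z satisfies d x z < t, hence
     d x a < 2 t, d x (p x) < 4 t and d a (p x) < 6 t. *)
  apply/nbhs_d; exists (Num.min e1 e2 / 6).
    by rewrite divr_gt0// lt_min e10.
  move=> z /= az; apply: WW'.
  have [az1 az2] : 6 * d (\val a) z < e1 /\ 6 * d (\val a) z < e2.
    by apply/andP; rewrite -lt_min mulrC -ltr_pdivlMr.
  have dz0 := is_metric_ge0 (\val a) z.
  have [/memA[a' a'z]|nAz] := pselect (A z).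
    by rewrite -a'z fA; apply: (gWV a' _).1; rewrite a'z; lra.
  rewrite fnA//; have [_ hK] := hP z (Psi0 z nAz); apply: hK => // c.
  move=> [x [nAx xz zc xc]].
  have xp := pP x nAx a; have xa := dD x z (\val a).
  have ap := dD (\val a) x (\val (p x)).
  rewrite (dC z) in xa; rewrite (dC (\val a) x) in ap.
  have [Wp Vp] : W (g (p x)) /\ V (g (p x)) by apply: gWV; lra.
  rewrite xc//; apply: UV; split=> //=; apply: e1U => /=.
  by rewrite dC; lra.
- have [/memA[a <-]|nAz] := pselect (A z).
    by rewrite fA; have /PhiP := gPhi a => ga; apply/PhiP.
  rewrite fnA//; have [_ hK] := hP z (Psi0 z nAz); apply: hK; first exact: Phic.
  by move=> c [x [_ _ zc _]]; apply/PhiP.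
Qed.

End metrized_space.

Theorem corollary3p6 (R : realType) (X : topologicalType) (A : set X)
    (E : tvsType R) (Phi : set (X * E)) :
  metrizable R X ->
  closed A ->
  hausdorff_space E ->
  nonempty_valued Phi ->
  convex_valued Phi ->
  open Phi ->
  forall g : A -> E,
    continuous g ->
    selection (restrict_rel Phi A) g ->
    exists f : X -> E,
      [/\ continuous f, selection Phi f & forall a : A, f (\val a) = g a].
Proof.
move=> [d [d_metric nbhs_d]] Acl _.
exact: selection_extension d_metric nbhs_d A E Phi Acl.
Qed.
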